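(* In dimension $n=3$, the absolute minimum of $E(3,a)$ among $a\in[0,2)$ occurs at $a=0$.
   Context: Here $\|\cdot\|$ is the Euclidean norm on $\mathbb{R}^n$, $e_1$ is the first canonical basis vector and $x_1$ is the first coordinate of $x\in\mathbb{R}^n$. For $a\in\mathbb{R}$, $\mathbb{S}_a=\{x\in\mathbb{R}^n:\|x-ae_1\|=1\}$ and $\sigma_a$ is the normalized (total mass one) surface measure on $\mathbb{S}_a$: $\sigma_0$ is the rotation-invariant Borel probability measure on the unit sphere $\mathbb{S}_0$, and $\sigma_a(A+ae_1)=\sigma_0(A)$ for Borel sets $A$. Let $\rho=\frac12(\sigma_{-1}+\sigma_1)$, a Borel probability measure with support $S=\mathbb{S}_{-1}\cup\mathbb{S}_1$. Mean-squared error: for a Borel measurable subset $S_1\subset S$ with complement $S_2=S\setminus S_1$, $$\mathcal{E}(S_1)=\min_{c_1\in\mathbb{R}^n}\int_{S_1}\|x-c_1\|^2\,d\rho(x)+\min_{c_2\in\mathbb{R}^n}\int_{S_2}\|x-c_2\|^2\,d\rho(x).$$ For the measure $\rho$ in dimension $n$, set $E(n,a)=\mathcal{E}(\{x\in S: x_1\le -a\})$. *)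

(* Defs.v *)
From HB Require Import structures.
From mathcomp Require Import all_boot all_order all_algebra.
From mathcomp Require Import all_classical all_reals all_analysis.

Set Implicit Arguments.
Unset Strict Implicit.
Unset Printing Implicit Defensive.

Import Order.TTheory GRing.Theory Num.Theory numFieldNormedType.Exports.

Local Open Scope classical_set_scope.
Local Open Scope ring_scope.

(* R^n with its Borel sigma-algebra. The library norm on row vectors is the
   sup norm; it has the same open sets as the Euclidean norm below. *)
Notation euclid R n := (g_sigma_algebraType (open : set (set 'rV[R]_n))).

Definition enorm (R : realType) (n : nat) (x : 'rV[R]_n) : R :=
  Num.sqrt (\sum_(i < n) x 0 i ^+ 2).

(* From here on the dimension is n.+1, so that there is a first coordinate. *)
Definition e1 (R : realType) (n : nat) : 'rV[R]_n.+1 := delta_mx 0 0.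

Definition sphere {R : realType} (n : nat) (a : R) : set 'rV[R]_n.+1 :=
  [set x | enorm (x - a *: e1 R n) = 1].
Arguments sphere {R} n a.

(* For dimension at least 2 this determines sigma0 uniquely. *)
Definition uniform_sphere (R : realType) (n : nat)
    (sigma0 : probability (euclid R n.+1) R) : Prop :=
  sigma0 (sphere n 0) = 1%E /\
  forall Q : 'M[R]_n.+1, Q *m Q^T = 1%:M -> \det Q = 1 ->
  forall A : set (euclid R n.+1), measurable A ->
    sigma0 [set x | A (x *m Q)] = sigma0 A.

Definition translate (R : realType) (n : nat) (a : R)
    (x : euclid R n.+1) : euclid R n.+1 :=
  (x : 'rV[R]_n.+1) + a *: e1 R n.

Lemma measurable_translate (R : realType) (n : nat) (a : R) :
  measurable_fun [set: euclid R n.+1] (@translate R n a).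
Proof.
apply: (@measurability _ _ (euclid R n.+1) (euclid R n.+1) _ _
  (open : set (set 'rV[R]_n.+1))) => //.
move=> _ [B oB <-]; rewrite setTI; apply: sub_sigma_algebra.
have ctr : continuous (fun x : 'rV[R]_n.+1 => x + a *: e1 R n).
  move=> x; apply: (@continuousD R 'rV[R]_n.+1 'rV[R]_n.+1 id
    (fun=> a *: e1 R n)); first exact: cvg_id.
  exact: cst_continuous.
by move/continuousP : ctr; exact.
Qed.

HB.instance Definition _ (R : realType) (n : nat) (a : R) :=
  isMeasurableFun.Build _ _ _ _ (@translate R n a)
    (@measurable_translate R n a).

Definition sigma (R : realType) (n : nat)
    (sigma0 : probability (euclid R n.+1) R) (a : R) :
    set (euclid R n.+1) -> \bar R :=
  distribution sigma0 (@translate R n a).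

HB.instance Definition _ (R : realType) (n : nat)
    (sigma0 : probability (euclid R n.+1) R) (a : R) :=
  Probability.on (sigma sigma0 a).

Definition rho (R : realType) (n : nat)
    (sigma0 : probability (euclid R n.+1) R) :
    set (euclid R n.+1) -> \bar R :=
  mscale (2^-1)%:nng (measure_add (sigma sigma0 (-1)) (sigma sigma0 1)).

HB.instance Definition _ (R : realType) (n : nat)
    (sigma0 : probability (euclid R n.+1) R) :=
  Measure.on (rho sigma0).

Definition two_spheres {R : realType} (n : nat) : set 'rV[R]_n.+1 :=
  sphere n (-1) `|` sphere n 1.
Arguments two_spheres {R} n.

(* The least element of A; the default value is irrelevant when, as below,
   A has one. *)
Definition minimum (R : realType) (A : set (\bar R)) : \bar R :=
  xget 0%E (A `&` lbound A).

(* The minimum over c is attained (at the barycenter of D if D has positive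
   mass), because rho is finite with bounded support. *)
Definition min_cost (R : realType) (n : nat)
    (sigma0 : probability (euclid R n.+1) R) (D : set (euclid R n.+1)) :
    \bar R :=
  minimum [set (\int[rho sigma0]_(x in D) (enorm (x - c) ^+ 2)%:E)%E
          | c in [set: 'rV[R]_n.+1]].

Definition mse (R : realType) (n : nat)
    (sigma0 : probability (euclid R n.+1) R) (S1 : set (euclid R n.+1)) :
    \bar R :=
  (min_cost sigma0 S1 + min_cost sigma0 (two_spheres n `\` S1))%E.

Definition cut_mse (R : realType) (n : nat)
    (sigma0 : probability (euclid R n.+1) R) (a : R) : \bar R :=
  mse sigma0 (two_spheres n `&` [set x | x 0 0 <= - a]).

(* Main.v *)
Require Import Defs.
From HB Require Import structures.
From mathcomp Require Import all_boot all_order all_algebra.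
From mathcomp Require Import all_classical all_reals all_analysis.
From mathcomp Require Import measurable_realfun.
From mathcomp Require Import ring lra.

Set Implicit Arguments.
Unset Strict Implicit.
Unset Printing Implicit Defensive.

Import Order.TTheory GRing.Theory Num.Theory numFieldNormedType.Exports.

Local Open Scope classical_set_scope.
Local Open Scope ring_scope.

(** In dimension 3 the error has the closed form E(3,a) = 1 + a^2/4 on [0,2)
    (lemma [cut_mseE]), which is least at a = 0.

    The reason is Archimedes' hat-box theorem: under the uniform measure of the
    unit sphere of R^3 the first coordinate X is uniform on [-1,1]
    ([archimedes_law]). The region x_1 <= -a then cuts off the part X <= 1 - a
    of the left sphere and a null part of the right one. The other coordinates
    are odd under rotations about the first axis, so the cost of a centre v on
    either region is an explicit quadratic polynomial in v whose coefficients
    are the mass and the first moment of X over that region. Completing the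
    square gives both minima ([min_cost_slice]), and they add up to 1 + a^2/4.

    As the measure is known only through its invariance under rotations, the
    hat-box theorem is derived from that invariance. Write Y for the second
    coordinate. Rotating the plane of the first two coordinates by the angle t
    gives, for every bounded Borel h,
      E[Y h(X cos t + Y sin t)] = sin t E[X h(X)],
    and letting t tend to 0 yields the integration by parts formula
      E[(1 - X^2) h'(X)] = 2 E[X h(X)].
    It is applied to h(y) = 1/max(1 + y, 1 + c), which is constant to the left
    of c ([kink_identity]); there it becomes a linear relation between P(X > c)
    and E[X; X > c]. The same relation for -c, transported by the reflection
    X -> -X, is a second one, and the two determine both quantities. The kink
    of h at c is the only delicate point: a symmetric difference quotient has
    there the mean of the two one-sided derivatives as its limit, so that the
    indicator of X > c is replaced by the step function taking the value 1/2
    at c. Comparing these steps for neighbouring values of c shows that X has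
    no atoms ([esphere_point]), and the usual distribution function follows. *)

(** * Coordinates and the unit sphere *)

Definition coordinate {R : realType} {n : nat} (i : 'I_n.+1)
    (x : euclid R n.+1) : R :=
  (x : 'rV[R]_n.+1) 0 i.

Lemma measurable_coordinate (R : realType) (n : nat) (i : 'I_n.+1) :
  measurable_fun [set: euclid R n.+1] (@coordinate R n i).
Proof.
move=> mD; apply: (measurability _ (RGenOInfty.measurableE R)) => //.
move=> _ [_ [a ->] <-]; rewrite setTI; apply: sub_sigma_algebra.
have /continuousP : continuous (fun x : 'rV[R]_n.+1 => x 0 i).
  exact: coord_continuous.
by apply; exact: interval_open.
Qed.

Lemma measurable_mulmx (R : realType) (n : nat) (Q : 'M[R]_n.+1) :
  measurable_fun [set: euclid R n.+1]
    ((fun x : 'rV[R]_n.+1 => x *m Q) : euclid R n.+1 -> euclid R n.+1).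
Proof.
apply: (@measurability _ _ (euclid R n.+1) (euclid R n.+1) _ _
  (open : set (set 'rV[R]_n.+1))) => //.
move=> _ [B oB <-]; rewrite setTI; apply: sub_sigma_algebra.
suff /continuousP : continuous (fun x : 'rV[R]_n.+1 => x *m Q) by exact.
under eq_fun do rewrite mulmx_sum_row.
apply: (@continuous_big _ _ +%R 0 xpredT (@add_continuous _)
  'rV[R]_n.+1 (index_enum _) (fun i x => x 0 i *: row i Q)) => i _ x.
apply: cvgZr_tmp; first exact: nbhs_filter.
exact: (@coord_continuous R 1 n.+1 0 i x).
Qed.

Lemma sphere0P (R : realType) (n : nat) (x : 'rV[R]_n.+1) :
  sphere n 0 x <-> \sum_i x 0 i ^+ 2 = 1.
Proof.
rewrite /sphere /enorm /= scale0r subr0.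
have s0 : 0 <= \sum_i x 0 i ^+ 2 by apply: sumr_ge0 => i _; exact: sqr_ge0.
split=> [h|->]; last exact: sqrtr1.
by rewrite -(sqr_sqrtr s0) h expr1n.
Qed.

Lemma measurable_sphere (R : realType) (n : nat) :
  measurable (sphere n 0 : set (euclid R n.+1)).
Proof.
have -> : sphere n 0 =
    [set x : euclid R n.+1 | \sum_i coordinate i x ^+ 2 == 1].
  by apply/seteqP; split => x; rewrite sphere0P /= /coordinate => /eqP.
rewrite -[X in measurable X]setTI.
apply: (measurable_fun_eqr _ (measurable_cst _)) => //.
apply: measurable_sum => i; apply: measurable_funX.
exact: measurable_coordinate.
Qed.

Lemma sphere_coordinate_le1 (R : realType) (n : nat) (x : euclid R n.+1) i :
  sphere n 0 x -> `|coordinate i x| <= 1.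
Proof.
move=> /sphere0P S1; rewrite -(@expr_le1 _ 2)//.
rewrite real_normK ?num_real// -S1 (bigD1 i)//= /coordinate lerDl.
by apply: sumr_ge0 => j _; exact: sqr_ge0.
Qed.

(** * Expectation over the unit sphere *)

Section sphere_expectation.
Context {R : realType} {n : nat} (sigma0 : probability (euclid R n.+1) R).
Implicit Types (f g : euclid R n.+1 -> R).
Local Notation S := (sphere n 0 : set (euclid R n.+1)).

Definition esphere f : R := \int[sigma0]_(x in S) f x.

(** A stable class of integrands. Bounds are required on the sphere alone,
    because the coordinates are unbounded on the whole space. *)
Definition admissible f : Prop :=
  measurable_fun setT f /\ exists M, forall x, S x -> `|f x| <= M.

Lemma admissible_cst a : admissible (fun=> a).
Proof. by split; [exact: measurable_cst|exists `|a|]. Qed.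

Lemma admissible_coordinate i : admissible (coordinate i).
Proof.
split; first exact: measurable_coordinate.
by exists 1 => x; exact: sphere_coordinate_le1.
Qed.

Lemma admissibleD f g :
  admissible f -> admissible g -> admissible (fun x => f x + g x).
Proof.
move=> [mf [M hM]] [mg [N hN]]; split; first exact: measurable_funD.
exists (M + N) => x Sx; rewrite (le_trans (ler_normD _ _))//.
by apply: lerD; [exact: hM|exact: hN].
Qed.

Lemma admissibleM f g :
  admissible f -> admissible g -> admissible (fun x => f x * g x).
Proof.
move=> [mf [M hM]] [mg [N hN]]; split; first exact: measurable_funM.
exists (M * N) => x Sx; rewrite normrM.
by apply: ler_pM => //; [exact: hM|exact: hN].
Qed.

Lemma admissibleZ a f : admissible f -> admissible (fun x => a * f x).
Proof. by move=> af; apply: admissibleM => //; exact: admissible_cst. Qed.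

Lemma admissibleN f : admissible f -> admissible (fun x => - f x).
Proof.
move=> [mf [M hM]]; split; first exact: measurable_funN.
by exists M => x Sx; rewrite normrN hM.
Qed.

Lemma admissibleX f k : admissible f -> admissible (fun x => f x ^+ k).
Proof.
move=> [mf [M hM]]; split; first exact: measurable_funX.
exists (M ^+ k) => x Sx.
by rewrite normrX lerXn2r ?nnegrE ?hM// (le_trans _ (hM _ Sx)).
Qed.

Lemma admissible_bool (b : euclid R n.+1 -> bool) :
  measurable_fun setT b -> admissible (fun x => (b x)%:R).
Proof.
move=> mb; split.
  exact: (measurableT_comp (f := fun c : bool => c%:R : R)).
by exists 1 => x _; case: (b x); rewrite ?normr1 ?normr0.
Qed.

Lemma admissible_bounded_comp (h : R -> R) (M : R) f :
  measurable_fun setT h -> (forall y, `|h y| <= M) -> admissible f ->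
  admissible (fun x => h (f x)).
Proof.
move=> mh hM [mf _]; split; first exact: measurableT_comp.
by exists M.
Qed.

Hypothesis hsigma0 : uniform_sphere sigma0.

Lemma admissible_integrable f :
  admissible f -> sigma0.-integrable S (EFin \o f).
Proof.
move=> [mf [M hM]]; apply: measurable_bounded_integrable.
- exact: measurable_sphere.
- by have /= -> := hsigma0.1; exact: ltry.
- exact: measurable_funTS.
- exists M; split; first exact: num_real.
  by move=> N MN x /hM /le_trans; apply; exact: ltW.
Qed.

Lemma eq_esphere f g : (forall x, S x -> f x = g x) -> esphere f = esphere g.
Proof. by move=> fg; apply: eq_Rintegral => x; rewrite inE; exact: fg. Qed.

Lemma esphere_cst a : esphere (fun=> a) = a.
Proof.
rewrite /esphere Rintegral_cst; last exact: measurable_sphere.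
by have /= -> := hsigma0.1; rewrite mulr1.
Qed.

Lemma esphereD f g : admissible f -> admissible g ->
  esphere (fun x => f x + g x) = esphere f + esphere g.
Proof.
move=> hf hg; apply: RintegralD;
  [exact: measurable_sphere|exact: admissible_integrable..].
Qed.

Lemma esphereZ a f : admissible f ->
  esphere (fun x => a * f x) = a * esphere f.
Proof.
move=> hf; apply: RintegralZl;
  [exact: measurable_sphere|exact: admissible_integrable].
Qed.

Lemma le_esphere f g : admissible f -> admissible g ->
  (forall x, S x -> f x <= g x) -> esphere f <= esphere g.
Proof.
move=> hf hg; apply: le_Rintegral;
  [exact: measurable_sphere|exact: admissible_integrable..].
Qed.

Lemma esphere_EFin f : admissible f ->
  (\int[sigma0]_(x in S) (f x)%:E)%E = (esphere f)%:E.
Proof.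
move=> ag; rewrite /esphere /Rintegral fineK//.
apply: integrable_fin_num; first exact: measurable_sphere.
exact: (admissible_integrable ag).
Qed.

(** The form of dominated convergence used below: an identity between
    expectations survives a pointwise limit under a uniform bound. *)
Lemma esphere_dominated (f_ : nat -> euclid R n.+1 -> R) f (M k : R) :
  (forall m, admissible (f_ m)) -> admissible f ->
  (forall m x, S x -> `|f_ m x| <= M) ->
  (forall x, S x -> f_ ^~ x @ \oo --> f x) ->
  (forall m, esphere (f_ m) = k) -> esphere f = k.
Proof.
move=> af_ af fM cvf Ef.
have mS : measurable S by exact: measurable_sphere.
have mf_ m : measurable_fun S (fun x => (f_ m x)%:E).
  by apply/measurable_EFinP; apply: measurable_funTS; exact: (af_ m).1.
have mf : measurable_fun S (fun x => (f x)%:E).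
  by apply/measurable_EFinP; apply: measurable_funTS; exact: af.1.
have cvE : {ae sigma0, forall x, S x ->
    (fun m => (f_ m x)%:E) @ \oo --> (f x)%:E}.
  by apply: aeW => x Sx; apply: cvg_EFin; [exact: nearW|exact: cvf].
have iM : sigma0.-integrable S (fun=> M%:E).
  exact: (admissible_integrable (admissible_cst M)).
have leM : {ae sigma0, forall x m, S x -> (`|(f_ m x)%:E| <= M%:E)%E}.
  by apply: aeW => x m Sx; rewrite /= lee_fin fM.
have [_ _] := dominated_convergence mS mf_ mf cvE iM leM.
rewrite (esphere_EFin af).
rewrite (_ : [sequence _]_n = (fun=> k%:E)); last first.
  by apply/funext => m /=; rewrite (esphere_EFin (af_ m)) Ef.
by move=> /(cvg_unique _ (cvg_cst _)) => /(_ (@ereal_hausdorff R)) [].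
Qed.

Lemma esphere_rotation (Q : 'M[R]_n.+1) f :
  Q *m Q^T = 1%:M -> \det Q = 1 -> admissible f ->
  esphere (fun x => f ((x : 'rV[R]_n.+1) *m Q)) = esphere f.
Proof.
move=> QQ dQ [mf hf].
have SQ (x : 'rV[R]_n.+1) : sphere n 0 (x *m Q) <-> sphere n 0 x.
  have nE (y : 'rV[R]_n.+1) : \sum_i y 0 i ^+ 2 = (y *m y^T) 0 0.
    by rewrite mxE; apply: eq_bigr => i _; rewrite mxE expr2.
  by rewrite !sphere0P !nE trmx_mul mulmxA -(mulmxA x) QQ mulmx1.
rewrite /esphere /Rintegral; congr fine.
pose phi := (fun x : 'rV[R]_n.+1 => x *m Q) : euclid R n.+1 -> euclid R n.+1.
have mphi : measurable_fun setT phi by exact: measurable_mulmx.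
have SE : phi @^-1` S = S by apply/seteqP; split => x /SQ.
transitivity (\int[pushforward sigma0 phi]_(x in S) (f x)%:E)%E; last first.
  by apply: eq_measure_integral => A mA _; exact: hsigma0.2.
rewrite integral_pushforward//.
- by rewrite SE.
- exact/measurable_EFinP.
- rewrite SE; apply: admissible_integrable; split.
    exact: measurableT_comp.
  by have [M hM] := hf; exists M => x /SQ/hM.
- exact: measurable_sphere.
Qed.

End sphere_expectation.

(** * A difference quotient with a kink *)

Section kink.
Context {R : realType}.
Implicit Types (c d x y : R) (n : nat).

(** The limit of the symmetric difference quotients of y |-> max(y, c). *)
Definition half_step c x : R := (c < x)%R%:R + 2^-1 * (x == c)%:R.

(** Right of d - 1 this cancels the factor 1 + y of 1 - y^2, so that
    integration by parts against it involves no moment beyond the first; left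
    of d - 1 it is constant. *)
Definition kink d y : R := (Num.max (1 + y) d)^-1.

(** The rational parametrization of the circle by the tangent of the half
    angle. It provides angles tending to 0 for which 1 - cos is visibly of
    smaller order than sin. *)
Definition tau n : R := n.+1%:R^-1.
Definition cos_ n : R := (1 - tau n ^+ 2) / (1 + tau n ^+ 2).
Definition sin_ n : R := 2 * tau n / (1 + tau n ^+ 2).

Lemma tau_gt0 n : 0 < tau n.
Proof. by rewrite invr_gt0 ltr0n. Qed.

Lemma cos2Dsin2 n : cos_ n ^+ 2 + sin_ n ^+ 2 = 1.
Proof.
have := tau_gt0 n; rewrite /cos_ /sin_; set t := tau n => t0.
by field; rewrite gt_eqF//; nra.
Qed.

Lemma sin_gt0 n : 0 < sin_ n.
Proof.
by have t0 := tau_gt0 n; rewrite divr_gt0//; nra.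
Qed.

Lemma cos_sub1 n : cos_ n - 1 = - tau n * sin_ n.
Proof.
have := tau_gt0 n; rewrite /cos_ /sin_; set t := tau n => t0.
by field; rewrite gt_eqF//; nra.
Qed.

Lemma cvg_tau : tau @ \oo --> (0 : R).
Proof. exact: cvg_harmonic. Qed.

Lemma cvg_sin : sin_ @ \oo --> (0 : R).
Proof.
have -> : (0 : R) = 2 * 0 / (1 + 0 ^+ 2) by rewrite mulr0 mul0r.
apply: cvgM; first by apply: cvgM; [exact: cvg_cst|exact: cvg_tau].
apply: cvgV; first by rewrite expr0n addr0 oner_neq0.
apply: cvgD; first exact: cvg_cst.
by under eq_fun do rewrite expr2; rewrite expr2; apply: cvgM; exact: cvg_tau.
Qed.

Lemma cvg_cos : cos_ @ \oo --> (1 : R).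
Proof.
rewrite (_ : cos_ = (fun n => - tau n * sin_ n + 1)); last first.
  by apply/funext => n; rewrite -cos_sub1 subrK.
rewrite -[X in _ --> X]add0r -[X in X + 1](mulr0 (- 0)).
apply: cvgD; last exact: cvg_cst.
by apply: cvgM; [apply: cvgN; exact: cvg_tau|exact: cvg_sin].
Qed.

Lemma half_step_ge0 c x : 0 <= half_step c x.
Proof. by rewrite addr_ge0// mulr_ge0. Qed.

Lemma half_step_le1 c x : half_step c x <= 1.
Proof.
rewrite /half_step; have [] := ltgtP x c => _;
  by rewrite ?mulr0 ?mulr1 ?addr0 ?add0r//; lra.
Qed.

Lemma measurable_half_step c : measurable_fun setT (half_step c).
Proof.
apply: measurable_funD.
  apply: (measurableT_comp (f := fun b : bool => b%:R : R)) => //.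
  by apply: measurable_fun_ltr.
apply: measurable_funM; first exact: measurable_cst.
apply: (measurableT_comp (f := fun b : bool => b%:R : R)) => //.
by apply: measurable_fun_eqr.
Qed.

Lemma half_step_norm_le1 c x : `|half_step c x| <= 1.
Proof. by rewrite ger0_norm ?half_step_ge0 ?half_step_le1. Qed.

(** A symmetric step of size B around the kink itself gives the difference B;
    moving its centre by A perturbs this by at most |A|. *)
Lemma max_sub_max (A B : R) :
  `|Num.max (A + B) 0 - Num.max (A - B) 0 - B| <= `|A|.
Proof.
rewrite /Num.max /=; case: ltP => h1; case: ltP => h2; rewrite ler_norml;
  case: (ger0P A) => A0; apply/andP; split; lra.
Qed.

Lemma max_shift (u d : R) : Num.max u d = d + Num.max (u - d) 0.
Proof.
by rewrite /Num.max; case: (ltP u d) => h1; case: (ltP (u - d) 0) => h2; lra.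
Qed.

(** Away from x = c both arguments eventually lie on the same side of the kink,
    so that the quotient is eventually constant. At x = c, up to the second order
    displacement of their centre, only one of the two arguments lies beyond the
    kink, and half of the full difference survives. *)
Lemma cvg_max_quotient c x y :
  (fun n => (Num.max (1 + (cos_ n * x + sin_ n * y)) (1 + c)
     - Num.max (1 + (cos_ n * x - sin_ n * y)) (1 + c)) / sin_ n) @ \oo
  --> 2 * y * half_step c x.
Proof.
have cvp : cos_ n * x + sin_ n * y @[n --> \oo] --> x.
  rewrite -[X in _ --> X]addr0 -[X in _ --> X + _]mul1r.
  rewrite -[X in _ --> _ + X](mul0r y).
  apply: cvgD; apply: cvgM;
    (exact: cvg_cst || exact: cvg_cos || exact: cvg_sin).
have cvm : cos_ n * x - sin_ n * y @[n --> \oo] --> x.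
  rewrite -[X in _ --> X]subr0 -[X in _ --> X - _]mul1r.
  rewrite -[X in _ --> _ - X](mul0r y).
  apply: cvgB; apply: cvgM;
    (exact: cvg_cst || exact: cvg_cos || exact: cvg_sin).
rewrite /half_step; have [xc|cx|->] := ltgtP x c.
- rewrite mulr0 addr0 mulr0; apply: cvg_near_cst; near=> n.
  have lp : cos_ n * x + sin_ n * y < c by near: n; exact: (cvgr_lt _ cvp).
  have lm : cos_ n * x - sin_ n * y < c by near: n; exact: (cvgr_lt _ cvm).
  by rewrite !max_r ?subrr ?mul0r// lerD2l ltW.
- rewrite mulr0 addr0 mulr1; apply: cvg_near_cst; near=> n.
  have lp : c < cos_ n * x + sin_ n * y by near: n; exact: (cvgr_gt _ cvp).
  have lm : c < cos_ n * x - sin_ n * y by near: n; exact: (cvgr_gt _ cvm).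
  rewrite !max_l ?lerD2l ?ltW//.
  by field; rewrite gt_eqF// sin_gt0.
rewrite mulr1 add0r mulrAC mulfV// mul1r.
(* The error |(cos - 1) c| / sin equals tau |c|. *)
have tau0 : tau k * `|c| @[k --> \oo] --> (0 : R).
  rewrite -[X in _ --> X](mul0r `|c|).
  by apply: cvgM; [exact: cvg_tau|exact: cvg_cst].
apply/cvgrPdist_le => e e0; near=> n.
have t0 := tau_gt0 n; have s0 := sin_gt0 n.
have tx : tau n * `|c| <= e by near: n; exact: (cvgr_le _ tau0).
rewrite distrC; apply: le_trans tx.
rewrite (max_shift (1 + (_ + _))) (max_shift (1 + (_ - _))).
have := max_sub_max ((cos_ n - 1) * c) (sin_ n * y).
set p := Num.max _ 0; set q := Num.max _ 0.
set p' := Num.max _ 0; set q' := Num.max _ 0 => H.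
have -> : p' = p by congr Num.max; ring.
have -> : q' = q by congr Num.max; ring.
have -> : (1 + c + p - (1 + c + q)) / sin_ n - y =
    (p - q - sin_ n * y) / sin_ n.
  by field; rewrite gt_eqF.
rewrite normrM normfV (gtr0_norm s0) ler_pdivrMr//.
rewrite (le_trans H)// cos_sub1 (normrM _ c) (normrM _ (sin_ n)) normrN.
rewrite (gtr0_norm t0) (gtr0_norm s0); lra.
Unshelve. all: by end_near. Qed.

Lemma continuous_kink d : 0 < d -> continuous (kink d).
Proof.
move=> d0 x; apply: cvgV; first by rewrite gt_eqF// lt_max d0 orbT.
under eq_cvg do rewrite maxr_absE.
rewrite maxr_absE; apply: cvgM; last exact: cvg_cst.
have c1 : 1 + y @[y --> x] --> 1 + x.
  by apply: cvgD; [exact: cvg_cst|exact: cvg_id].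
apply: cvgD; first by apply: cvgD; [exact: c1|exact: cvg_cst].
by apply: cvg_norm; apply: cvgB; [exact: c1|exact: cvg_cst].
Qed.

Lemma kink_norm_le d y : 0 < d -> `|kink d y| <= d^-1.
Proof.
move=> d0; rewrite /kink normfV lef_pV2 ?posrE ?normr_gt0//.
  by rewrite (le_trans _ (ler_norm _))// le_max lexx orbT.
by rewrite gt_eqF// lt_max d0 orbT.
Qed.

Lemma kink_lipschitz d (u v : R) :
  0 < d -> `|kink d u - kink d v| <= d^-1 ^+ 2 * `|u - v|.
Proof.
move=> d0.
have h (w : R) : 0 < kink d w /\ kink d w <= d^-1.
  have m0 : 0 < Num.max (1 + w) d by rewrite lt_max d0 orbT.
  by rewrite /kink invr_gt0 m0 lef_pV2 ?posrE// le_max lexx orbT.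
have [pu ku] := h u; have [pv kv] := h v.
have -> : kink d u - kink d v =
    kink d u * kink d v * (Num.max (1 + v) d - Num.max (1 + u) d).
  rewrite /kink; field.
  by rewrite !gt_eqF// lt_max d0 orbT.
rewrite normrM ger0_norm ?mulr_ge0 ?(ltW pu) ?(ltW pv)//.
apply: ler_pM => //; first by rewrite mulr_ge0 ?(ltW pu) ?(ltW pv).
  by rewrite expr2; apply: ler_pM => //; exact: ltW.
have uv := ler_norm (u - v); have vu := ler_norm (v - u).
rewrite distrC in vu; rewrite /Num.max ler_norml.
move: `|u - v| uv vu => N uv vu.
by case: (ltP (1 + v)) => h1; case: (ltP (1 + u)) => h2; lra.
Qed.

Lemma cvg_kink_quotient c x y : 0 < 1 + c ->
  (fun n => y * ((kink (1 + c) (cos_ n * x + sin_ n * y)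
     - kink (1 + c) (cos_ n * x - sin_ n * y)) / sin_ n)) @ \oo
  --> - 2 * (y ^+ 2 * (half_step c x * kink (1 + c) x ^+ 2)).
Proof.
move=> d0.
have m0 u : Num.max u (1 + c) != 0 by rewrite gt_eqF// lt_max d0 orbT.
have cvh t : kink (1 + c) (cos_ n * x + t * sin_ n * y) @[n --> \oo] -->
    kink (1 + c) x.
  apply: continuous_cvg; first exact: continuous_kink.
  rewrite -[X in _ --> X]addr0 -[X in _ --> X + _]mul1r.
  rewrite -[X in _ --> _ + X](mul0r y) -(mulr0 t).
  by apply: cvgD; apply: cvgM; try apply: cvgM;
    (exact: cvg_cst || exact: cvg_cos || exact: cvg_sin).
have -> : - 2 * (y ^+ 2 * (half_step c x * kink (1 + c) x ^+ 2)) =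
  - y * (2 * y * half_step c x) * kink (1 + c) x * kink (1 + c) x by ring.
rewrite (_ : (fun n => _) = (fun n => - y *
  ((Num.max (1 + (cos_ n * x + sin_ n * y)) (1 + c)
     - Num.max (1 + (cos_ n * x - sin_ n * y)) (1 + c)) / sin_ n)
  * kink (1 + c) (cos_ n * x + 1 * sin_ n * y)
  * kink (1 + c) (cos_ n * x + (-1) * sin_ n * y))).
  do 2 (apply: cvgM => //).
  by apply: cvgM; [exact: cvg_cst|exact: cvg_max_quotient].
apply/funext => n; have /lt0r_neq0 s0 := sin_gt0 n.
rewrite mul1r mulN1r mulNr /kink.
by field; rewrite s0 !m0.
Qed.

End kink.

(** * Rotations of three-dimensional space *)

Local Notation xc := (coordinate (0 : 'I_3)).
Local Notation yc := (coordinate (1 : 'I_3)).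
Local Notation zc := (coordinate (2%:R : 'I_3)).

Definition matrix3 {R : realType} (r : seq (seq R)) : 'M[R]_3 :=
  \matrix_(i < 3, j < 3) nth 0 (nth [::] r i) j.

Lemma sum3 (V : nmodType) (F : 'I_3 -> V) :
  \sum_i F i = F 0 + F 1 + F 2%:R.
Proof.
rewrite !big_ord_recl big_ord0 addr0 addrA.
by congr (F _ + F _ + F _); apply: val_inj.
Qed.

Lemma matrix3_1 (R : realType) :
  1%:M = matrix3 [:: [:: 1; 0; 0]; [:: 0; 1; 0]; [:: 0; 0; 1]] :> 'M[R]_3.
Proof.
by apply/matrixP => -[[|[|[|//]]] ?] -[[|[|[|//]]] ?]; rewrite !mxE.
Qed.

Lemma matrix3_mulT (R : realType) (a b c d e f g h i : R) :
  let M := matrix3 [:: [:: a; b; c]; [:: d; e; f]; [:: g; h; i]] in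
  M *m M^T = matrix3
   [:: [:: a*a+b*b+c*c; a*d+b*e+c*f; a*g+b*h+c*i];
       [:: a*d+b*e+c*f; d*d+e*e+f*f; d*g+e*h+f*i];
       [:: a*g+b*h+c*i; d*g+e*h+f*i; g*g+h*h+i*i]].
Proof.
apply/matrixP => -[[|[|[|//]]] ?] -[[|[|[|//]]] ?];
  by rewrite !mxE sum3 !mxE /=; ring.
Qed.

Lemma det_matrix3 (R : realType) (a b c d e f g h i : R) :
  \det (matrix3 [:: [:: a; b; c]; [:: d; e; f]; [:: g; h; i]]) =
  a * (e * i - f * h) - b * (d * i - f * g) + c * (d * h - e * g).
Proof.
rewrite (expand_det_row _ 0) !big_ord_recl big_ord0 /cofactor.
rewrite !(expand_det_row _ 0) !big_ord_recl !big_ord0 /cofactor !det_mx11.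
rewrite !mxE /=.
by rewrite /bump /=; ring.
Qed.

Section space3.
Context {R : realType} (sigma0 : probability (euclid R 3) R).
Hypothesis hsigma0 : uniform_sphere sigma0.
Local Notation E := (esphere sigma0).

Lemma esphere_rot_xy (F : R -> R -> R -> R) (c s : R) :
  c ^+ 2 + s ^+ 2 = 1 ->
  admissible (fun x : euclid R 3 => F (xc x) (yc x) (zc x)) ->
  E (fun x => F (c * xc x + s * yc x) (c * yc x - s * xc x) (zc x)) =
  E (fun x => F (xc x) (yc x) (zc x)).
Proof.
move=> cs aF.
pose Q := matrix3 [:: [:: c; - s; 0]; [:: s; c; 0]; [:: 0; 0; 1]].
have QQ : Q *m Q^T = 1%:M.
  rewrite matrix3_mulT matrix3_1; congr (matrix3 _).
  do ![congr cons]; nra.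
have dQ : \det Q = 1 by rewrite det_matrix3; nra.
rewrite -(esphere_rotation hsigma0 QQ dQ aF).
apply: eq_esphere => // x _; rewrite /coordinate !mxE !sum3 !mxE /=.
by congr F; ring.
Qed.

Lemma esphere_rot_yz (F : R -> R -> R -> R) (c s : R) :
  c ^+ 2 + s ^+ 2 = 1 ->
  admissible (fun x : euclid R 3 => F (xc x) (yc x) (zc x)) ->
  E (fun x => F (xc x) (c * yc x + s * zc x) (c * zc x - s * yc x)) =
  E (fun x => F (xc x) (yc x) (zc x)).
Proof.
move=> cs aF.
pose Q := matrix3 [:: [:: 1; 0; 0]; [:: 0; c; - s]; [:: 0; s; c]].
have QQ : Q *m Q^T = 1%:M.
  rewrite matrix3_mulT matrix3_1; congr (matrix3 _).
  do ![congr cons]; nra.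
have dQ : \det Q = 1 by rewrite det_matrix3; nra.
rewrite -(esphere_rotation hsigma0 QQ dQ aF).
apply: eq_esphere => // x _; rewrite /coordinate !mxE !sum3 !mxE /=.
by congr F; ring.
Qed.

(** * Integration by parts on the sphere *)

Section bounded_profile.
Variables (h : R -> R) (M : R).
Hypotheses (mh : measurable_fun setT h) (hM : forall y, `|h y| <= M).

(** The half turn about the first axis changes the sign of the second
    coordinate and fixes the first one. *)
Lemma esphere_y_odd : E (fun x => yc x * h (xc x)) = 0.
Proof.
have ah : admissible (fun x : euclid R 3 => yc x * h (xc x)).
  by apply: admissibleM; [exact: admissible_coordinate|
    apply: (admissible_bounded_comp mh hM); exact: admissible_coordinate].
have := @esphere_rot_yz (fun x y z => y * h x) (-1) 0.
rewrite sqrrN expr1n expr0n addr0 => /(_ erefl ah).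
have -> : E (fun x => (-1 * yc x + 0 * zc x) * h (xc x)) =
    E (fun x => -1 * (yc x * h (xc x))).
  by apply: eq_esphere => // x _; ring.
rewrite esphereZ//; lra.
Qed.

Lemma esphere_z_odd : E (fun x => zc x * h (xc x)) = 0.
Proof.
rewrite -esphere_y_odd.
rewrite -(@esphere_rot_yz (fun x y z => y * h x) 0 1); last 2 first.
- by ring.
- by apply: admissibleM; [exact: admissible_coordinate|
    apply: (admissible_bounded_comp mh hM); exact: admissible_coordinate].
by apply: eq_esphere => // x _; ring.
Qed.

(** A quarter turn about the first axis exchanges the squares of the two other
    coordinates, whose sum is 1 - X^2 on the sphere. *)
Lemma esphere_y2 :
  E (fun x => yc x ^+ 2 * h (xc x)) =
  2^-1 * E (fun x => (1 - xc x ^+ 2) * h (xc x)).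
Proof.
have ah i : admissible (fun x : euclid R 3 => coordinate i x ^+ 2 * h (xc x)).
  by apply: admissibleM; [apply: admissibleX; exact: admissible_coordinate|
    apply: (admissible_bounded_comp mh hM); exact: admissible_coordinate].
have yz : E (fun x => yc x ^+ 2 * h (xc x)) = E (fun x => zc x ^+ 2 * h (xc x)).
  rewrite -(@esphere_rot_yz (fun x y z => y ^+ 2 * h x) 0 1)//; last by ring.
  by apply: eq_esphere => // x _; ring.
have -> : E (fun x => (1 - xc x ^+ 2) * h (xc x)) =
    E (fun x => yc x ^+ 2 * h (xc x) + zc x ^+ 2 * h (xc x)).
  apply: eq_esphere => // x /sphere0P; rewrite sum3 => S1.
  rewrite -mulrDl; congr (_ * _); rewrite -S1 /coordinate; ring.
rewrite esphereD// -yz; lra.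
Qed.

(** The test function is (s X + c Y) h(X): the rotation turns its first factor
    into Y, and its second summand is odd. *)
Lemma esphere_rotate_profile (c s : R) : c ^+ 2 + s ^+ 2 = 1 ->
  E (fun x => yc x * h (c * xc x + s * yc x)) =
  s * E (fun x => xc x * h (xc x)).
Proof.
move=> cs.
have ah i : admissible (fun x : euclid R 3 => coordinate i x * h (xc x)).
  by apply: admissibleM; [exact: admissible_coordinate|
    apply: (admissible_bounded_comp mh hM); exact: admissible_coordinate].
have hF : E (fun x => (s * xc x + c * yc x) * h (xc x)) =
    s * E (fun x => xc x * h (xc x)).
  transitivity (E (fun x => s * (xc x * h (xc x)) + c * (yc x * h (xc x)))).
    by apply: eq_esphere => // x _; ring.
  rewrite esphereD//; try exact: admissibleZ.
  by rewrite !esphereZ// esphere_y_odd mulr0 addr0.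
rewrite -hF.
rewrite -(@esphere_rot_xy (fun x y z => (s * x + c * y) * h x) c s cs);
    last first.
  apply: admissibleM; last first.
    by apply: (admissible_bounded_comp mh hM); exact: admissible_coordinate.
  by apply: admissibleD; apply: admissibleM;
    (exact: admissible_cst || exact: admissible_coordinate).
apply: eq_esphere => // x _; congr (_ * _).
transitivity ((c ^+ 2 + s ^+ 2) * yc x); last by ring.
by rewrite cs mul1r.
Qed.

(** Opposite angles are combined into a symmetric difference quotient, whose
    limit at the kink of [kink] is the mean of the one-sided derivatives. *)
Lemma esphere_difference_quotient (c s : R) : c ^+ 2 + s ^+ 2 = 1 -> s != 0 ->
  E (fun x => yc x *
       ((h (c * xc x + s * yc x) - h (c * xc x - s * yc x)) / s)) =
  2 * E (fun x => xc x * h (xc x)).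
Proof.
move=> cs s0.
have Hp := esphere_rotate_profile cs.
have csN : c ^+ 2 + (- s) ^+ 2 = 1 by rewrite sqrrN.
have Hm := esphere_rotate_profile csN.
have ah t : admissible (fun x : euclid R 3 => yc x * h (c * xc x + t * yc x)).
  apply: admissibleM; first exact: admissible_coordinate.
  apply: (admissible_bounded_comp mh hM).
  by apply: admissibleD; apply: admissibleM;
    (exact: admissible_cst || exact: admissible_coordinate).
transitivity (E (fun x => s^-1 * (yc x * h (c * xc x + s * yc x)) +
    (- s^-1) * (yc x * h (c * xc x + (- s) * yc x)))).
  by apply: eq_esphere => // x _; rewrite (mulNr s (yc x)); field.
rewrite esphereD//; try exact: admissibleZ.
by rewrite !esphereZ// Hp Hm; field.
Qed.

End bounded_profile.

(** * Archimedes' hat-box theorem *)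


Lemma admissible_half_step (c : R) :
  admissible (fun x : euclid R 3 => half_step c (xc x)).
Proof.
exact: (admissible_bounded_comp (measurable_half_step c) (half_step_norm_le1 c)
  (admissible_coordinate _)).
Qed.

Lemma esphere_x_odd : E (fun x => xc x) = 0.
Proof.
have := @esphere_rot_xy (fun x y z => x) (-1) 0.
rewrite sqrrN expr1n expr0n addr0 => /(_ erefl (admissible_coordinate _)).
have -> : E (fun x => -1 * xc x + 0 * yc x) = E (fun x => -1 * xc x).
  by apply: eq_esphere => // x _; ring.
rewrite esphereZ//; last exact: admissible_coordinate.
lra.
Qed.

(** Integration by parts for h = [kink (1 + c)], whose derivative is
    - [half_step c] h^2 with the mean of both derivatives at c. *)
Lemma kink_identity (c : R) : -1 < c ->
  E (fun x => (1 - xc x ^+ 2) *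
              (half_step c (xc x) * kink (1 + c) (xc x) ^+ 2)) =
  - 2 * E (fun x => xc x * kink (1 + c) (xc x)).
Proof.
move=> c1; have d0 : 0 < 1 + c by lra.
set d := 1 + c in d0 *.
have mk : measurable_fun setT (kink d).
  by apply: continuous_measurable_fun; exact: continuous_kink.
have kM := fun y => kink_norm_le y d0.
pose g y := half_step c y * kink d y ^+ 2.
have mg : measurable_fun setT g.
  apply: measurable_funM; first exact: measurable_half_step.
  exact: measurable_funX.
have gM y : `|g y| <= 1 * d^-1 ^+ 2.
  rewrite normrM ler_pM ?half_step_norm_le1// normrX.
  by rewrite lerXn2r ?nnegrE ?kM// invr_ge0 ltW.
have ag : admissible (fun x : euclid R 3 => yc x ^+ 2 * g (xc x)).
  apply: admissibleM; first by apply: admissibleX; exact: admissible_coordinate.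
  by apply: (admissible_bounded_comp mg gM); exact: admissible_coordinate.
have key := @esphere_dominated _ _ _ hsigma0
  (fun n x => yc x * ((kink d (cos_ n * xc x + sin_ n * yc x)
     - kink d (cos_ n * xc x - sin_ n * yc x)) / sin_ n))
  (fun x => - 2 * (yc x ^+ 2 * g (xc x)))
  (d^-1 ^+ 2 * 2) (2 * E (fun x => xc x * kink d (xc x))).
have : E (fun x => - 2 * (yc x ^+ 2 * g (xc x))) =
    2 * E (fun x => xc x * kink d (xc x)).
  apply: key.
  - move=> n.
    apply: admissibleM; first exact: admissible_coordinate.
    apply: admissibleM; last exact: admissible_cst.
    apply: admissibleD; last apply: admissibleN;
    apply: (admissible_bounded_comp mk kM); apply: admissibleD;
    try apply: admissibleN; apply: admissibleM;
    (exact: admissible_cst || exact: admissible_coordinate).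
  - exact: admissibleZ.
  - move=> n x Sx; have s0 := sin_gt0 n (R := R).
    have y1 := sphere_coordinate_le1 1 Sx.
    rewrite normrM -[leRHS]mul1r; apply: ler_pM => //.
    rewrite normrM normfV (gtr0_norm s0) ler_pdivrMr//.
    apply: (le_trans (kink_lipschitz _ _ d0)).
    rewrite -(mulrA _ 2 (sin_ n)) ler_wpM2l ?sqr_ge0//.
    rewrite (_ : _ - _ = (2 * sin_ n) * yc x); last by ring.
    have ss0 : 0 < 2 * (sin_ n : R) by apply: mulr_gt0.
    rewrite (normrM (2 * _)) (gtr0_norm ss0).
    by apply: ler_piMr => //; exact: ltW.
  - move=> x _; exact: cvg_kink_quotient.
  - move=> n; apply: (esphere_difference_quotient mk kM (cos2Dsin2 n)).
    by rewrite gt_eqF// sin_gt0.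
rewrite esphereZ// (esphere_y2 mg gM); lra.
Qed.

(** Combining the two sides of [kink_identity]: to the right of c,
    (1 - u^2) h^2 + 2 u h is 1, and to its left it is the multiple
    2 u / (1 + c) of u; at c it is the mean of the two. *)
Lemma half_step_first_moment (c : R) : -1 < c ->
  (1 + c) * E (fun x => half_step c (xc x)) =
  2 * E (fun x => xc x * half_step c (xc x)).
Proof.
move=> c1; have d0 : 0 < 1 + c by lra.
have ki := kink_identity c1.
have mk : measurable_fun setT (kink (1 + c)).
  by apply: continuous_measurable_fun; exact: continuous_kink.
have kM := fun y => kink_norm_le y d0.
have ax : admissible (fun x : euclid R 3 => xc x).
  exact: admissible_coordinate.
have aw := admissible_half_step c.
have ak : admissible (fun x : euclid R 3 => kink (1 + c) (xc x)).
  exact: (admissible_bounded_comp mk kM).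
have axw := admissibleM ax aw.
have axk := admissibleM ax ak.
have awk : admissible (fun x : euclid R 3 => (1 - xc x ^+ 2) *
              (half_step c (xc x) * kink (1 + c) (xc x) ^+ 2)).
  apply: admissibleM; last by apply: admissibleM => //; exact: admissibleX.
  apply: admissibleD; first exact: admissible_cst.
  by apply: admissibleN; exact: admissibleX.
have : E (fun x => (1 - xc x ^+ 2) *
              (half_step c (xc x) * kink (1 + c) (xc x) ^+ 2)
            + 2 * (xc x * kink (1 + c) (xc x))) =
       E (fun x => half_step c (xc x) + ((2 / (1 + c)) * xc x +
           (- (2 / (1 + c))) * (xc x * half_step c (xc x)))).
  apply: eq_esphere => // x _; set u := xc x.
  rewrite /half_step /kink; have [uc|cu|->] := ltgtP u c;
    rewrite /= ?mulr0n ?mulr1n.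
  - by rewrite max_r ?lerD2l ?ltW//; field; lra.
  - by rewrite max_l ?lerD2l ?ltW//; field; lra.
  - by rewrite max_l//; field; lra.
have a1 := admissibleZ 2 axk.
have a2 := admissibleZ (2 / (1 + c)) ax.
have a3 := admissibleZ (- (2 / (1 + c))) axw.
have a4 := admissibleD a2 a3.
rewrite (esphereD hsigma0 awk a1) (esphereD hsigma0 aw a4).
rewrite (esphereD hsigma0 a2 a3).
rewrite !esphereZ// ki esphere_x_odd => H.
set W := E (fun x => half_step c (xc x)) in H *.
set V := E (fun x => xc x * half_step c (xc x)) in H *.
have -> : W = 2 / (1 + c) * V by lra.
by field; lra.
Qed.

Lemma esphere_reflect_x (F : R -> R) :
  admissible (fun x : euclid R 3 => F (xc x)) ->
  E (fun x => F (- xc x)) = E (fun x => F (xc x)).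
Proof.
move=> aF; have := @esphere_rot_xy (fun x y z => F x) (-1) 0.
rewrite sqrrN expr1n expr0n addr0 => /(_ erefl aF) <-.
by apply: eq_esphere => // x _; congr F; ring.
Qed.

(** The moment relation for c and, after the reflection, the one for - c form
    a linear system for the mass and the first moment. *)
Lemma half_step_law (c : R) : -1 < c < 1 ->
  E (fun x => half_step c (xc x)) = (1 - c) / 2 /\
  E (fun x => xc x * half_step c (xc x)) = (1 - c ^+ 2) / 4.
Proof.
move=> /andP[c1 c2].
have h1 := half_step_first_moment c1.
have h2 : (1 + - c) * E (fun x => half_step (- c) (xc x)) =
    2 * E (fun x => xc x * half_step (- c) (xc x)).
  by apply: half_step_first_moment; lra.
have flip u : half_step (- c) (- u) = 1 - half_step c u.
  rewrite /half_step ltrN2 eqr_opp.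
  by have [] := ltgtP u c => _; rewrite /= ?mulr0n ?mulr1n; lra.
have ax : admissible (fun x : euclid R 3 => xc x).
  exact: admissible_coordinate.
have aw k := admissible_half_step k.
have axw k := admissibleM ax (aw k).
have e1 : E (fun x => half_step (- c) (xc x)) =
    1 - E (fun x => half_step c (xc x)).
  rewrite -esphere_reflect_x//.
  transitivity (E (fun x => 1 + (-1) * half_step c (xc x))).
    by apply: eq_esphere => // x _; rewrite flip; ring.
  rewrite (esphereD hsigma0 (admissible_cst 1) (admissibleZ (-1) (aw c))).
  by rewrite esphereZ// esphere_cst//; ring.
have e2 : E (fun x => xc x * half_step (- c) (xc x)) =
    E (fun x => xc x * half_step c (xc x)).
  rewrite -(@esphere_reflect_x (fun u => u * half_step (- c) u))//.
  transitivity (E (fun x => (-1) * xc x + xc x * half_step c (xc x))).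
    by apply: eq_esphere => // x _; rewrite flip; ring.
  rewrite (esphereD hsigma0 (admissibleZ (-1) ax) (axw c)).
  by rewrite esphereZ// esphere_x_odd; ring.
rewrite e1 e2 in h2.
split; first by lra.
have -> : E (fun x => xc x * half_step c (xc x)) =
  (1 + c) * E (fun x => half_step c (xc x)) / 2 by rewrite h1; field.
have -> : E (fun x => half_step c (xc x)) = (1 - c) / 2 by lra.
by field.
Qed.

Lemma admissible_point (c : R) :
  admissible (fun x : euclid R 3 => (xc x == c)%:R).
Proof.
apply: admissible_bool; apply: measurable_fun_eqr => //.
exact: measurable_coordinate.
Qed.

(** An atom at c is at most the difference of the steps at c - r and c + r,
    of expectation r; at the end point -1 the left step is replaced by 1. *)
Lemma esphere_point (c : R) : -1 <= c < 1 -> E (fun x => (xc x == c)%:R) = 0.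
Proof.
move=> /andP[c1 c2]; have ap := admissible_point c.
have aw k := admissible_half_step k.
apply/eqP; rewrite eq_le; apply/andP; split; last by apply: Rintegral_ge0.
apply/ler_addgt0Pr => e e0; rewrite add0r.
move: c1; rewrite le_eqVlt => /orP[/eqP c1|c1].
  pose r := Num.min e 1.
  have [re r1] : r <= e /\ r <= 1 by rewrite /r !ge_min !lexx orbT.
  have r0 : 0 < r by rewrite /r lt_min e0/=; lra.
  have [up _] := @half_step_law (c + r) ltac:(lra).
  have : E (fun x => (xc x == c)%:R + half_step (c + r) (xc x)) <= E (fun=> 1).
    apply: (le_esphere hsigma0); [exact: admissibleD|exact: admissible_cst|].
    move=> x _; have := half_step_le1 (c + r) (xc x); move: (xc x) => u.
    rewrite /half_step; have [uc|uc|uc] := ltgtP u c;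
      have [ur|ur|ur] := ltgtP u (c + r); rewrite /= ?mulr0n ?mulr1n; lra.
  rewrite esphereD// esphere_cst// up; lra.
pose r := Num.min e (Num.min ((1 + c) / 2) ((1 - c) / 2)).
have [re rc rd] : [/\ r <= e, r <= (1 + c) / 2 & r <= (1 - c) / 2].
  by rewrite /r !ge_min !lexx !orbT.
have r0 : 0 < r by rewrite /r !lt_min e0/=; apply/andP; split; lra.
have [up _] := @half_step_law (c + r) ltac:(lra).
have [um _] := @half_step_law (c - r) ltac:(lra).
have : E (fun x => (xc x == c)%:R + half_step (c + r) (xc x)) <=
    E (fun x => half_step (c - r) (xc x)).
  apply: (le_esphere hsigma0) => //; first exact: admissibleD.
  move=> x _; move: (xc x) => u; rewrite /half_step.
  have [uc|uc|uc] := ltgtP u c; have [ur|ur|ur] := ltgtP u (c + r);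
    have [us|us|us] := ltgtP u (c - r); rewrite /= ?mulr0n ?mulr1n; lra.
rewrite esphereD// up um; lra.
Qed.

(** The mass and the first moment of the part X <= c, as for the uniform law
    on [-1,1]. *)
Lemma archimedes_law (c : R) : -1 <= c <= 1 ->
  E (fun x => (xc x <= c)%R%:R) = (1 + c) / 2 /\
  E (fun x => xc x * (xc x <= c)%R%:R) = - (1 - c ^+ 2) / 4.
Proof.
move=> /andP[c1]; have ap := admissible_point.
have ax : admissible (fun x : euclid R 3 => xc x).
  exact: admissible_coordinate.
have bound (x : euclid R 3) : sphere 2 0 x -> -1 <= xc x <= 1.
  by move=> Sx; have := sphere_coordinate_le1 0 Sx; rewrite ler_norml.
rewrite le_eqVlt => /orP[/eqP ->|c2].
  split.
    rewrite (@eq_esphere _ _ _ _ (fun=> 1)) ?esphere_cst//; first by lra.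
    by move=> x /bound/andP[_ ->].
  rewrite (@eq_esphere _ _ _ _ (fun x => xc x)) ?esphere_x_odd//; first by lra.
  by move=> x /bound/andP[_ ->]; rewrite mulr1.
have pt := @esphere_point c ltac:(lra).
move: c1; rewrite le_eqVlt => /orP[/eqP ce|c1].
  have xe (x : euclid R 3) : sphere 2 0 x -> (xc x <= c)%R = (xc x == c).
    by rewrite -ce => /bound/andP[h _]; rewrite eq_le h andbT.
  split.
    rewrite (@eq_esphere _ _ _ _ (fun x => (xc x == c)%:R)) ?pt; first by lra.
    by move=> x /xe ->.
  rewrite (@eq_esphere _ _ _ _ (fun x => c * (xc x == c)%:R)).
    by rewrite esphereZ// pt -ce; lra.
  by move=> x /xe ->; have [->//|_] := eqVneq (xc x) c; rewrite !mulr0.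
have [w0 w1] := @half_step_law c ltac:(lra).
have aw := admissible_half_step c; have axw := admissibleM ax aw.
split.
  transitivity (E (fun x => 1 + ((-1) * half_step c (xc x) +
      2^-1 * (xc x == c)%:R))).
    apply: eq_esphere => // x _; move: (xc x) => u; rewrite /half_step.
    by have [uc|uc|uc] := ltgtP u c; rewrite /= ?mulr0n ?mulr1n; lra.
  have a1 := admissibleZ (-1) aw; have a2 := admissibleZ 2^-1 (ap c).
  rewrite (esphereD hsigma0 (admissible_cst 1) (admissibleD a1 a2)).
  rewrite (esphereD hsigma0 a1 a2) !esphereZ// w0 pt esphere_cst//; lra.
transitivity (E (fun x => xc x + ((-1) * (xc x * half_step c (xc x)) +
    (2^-1 * c) * (xc x == c)%:R))).
  apply: eq_esphere => // x _; move: (xc x) => u; rewrite /half_step.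
  by have [uc|uc|->] := ltgtP u c; rewrite /= ?mulr0n ?mulr1n; lra.
have a1 := admissibleZ (-1) axw; have a2 := admissibleZ (2^-1 * c) (ap c).
rewrite (esphereD hsigma0 ax (admissibleD a1 a2)).
rewrite (esphereD hsigma0 a1 a2) !esphereZ// w1 pt esphere_x_odd; lra.
Qed.

End space3.

(** * Integrals over slices of the two spheres *)

Lemma minimum_least (R : realType) (A : set (\bar R)) (y : \bar R) :
  A y -> lbound A y -> minimum A = y.
Proof.
move=> Ay lAy; rewrite /minimum; apply: xget_unique => // z [Az lAz].
by apply/eqP; rewrite eq_le (lAz _ Ay) (lAy _ Az).
Qed.

Lemma coordinate_translate (R : realType) n (a : R) (x : euclid R n.+1) i :
  coordinate i (translate a x) = coordinate i x + a * (i == 0)%:R.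
Proof. by rewrite /coordinate /translate /e1 !mxE eqxx. Qed.

Lemma enorm_sub2 (R : realType) n (x v : 'rV[R]_n.+1) :
  enorm (x - v) ^+ 2 = \sum_i (x 0 i - v 0 i) ^+ 2.
Proof.
rewrite /enorm sqr_sqrtr; last by apply: sumr_ge0 => i _; exact: sqr_ge0.
by apply: eq_bigr => i _; rewrite !mxE.
Qed.

Lemma sphere_translate (R : realType) n (a : R) (x : euclid R n.+1) :
  sphere n 0 x -> sphere n a (translate a x).
Proof. by rewrite /sphere /translate /= scale0r subr0 addrK. Qed.

Lemma measurable_sphere_at (R : realType) n (a : R) :
  measurable (sphere n a : set (euclid R n.+1)).
Proof.
have -> : sphere n a =
    @translate R n (- a) @^-1` (sphere n 0 : set (euclid R n.+1)).
  apply/seteqP; split => x;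
    by rewrite /sphere /translate /= scale0r subr0 scaleNr.
rewrite -[X in measurable X]setTI; apply: measurable_translate => //.
exact: measurable_sphere.
Qed.

Section two_spheres_cost.
Context {R : realType} (sigma0 : probability (euclid R 3) R).
Hypothesis hsigma0 : uniform_sphere sigma0.
Local Notation E := (esphere sigma0).
Local Notation S := (sphere 2 0 : set (euclid R 3)).

Definition slice (b : R -> bool) : set (euclid R 3) :=
  two_spheres 2 `&` [set x | b (coordinate 0 x)].

Lemma measurable_slice (b : R -> bool) :
  measurable_fun setT b -> measurable (slice b).
Proof.
move=> mb; apply: measurableI.
  by apply: measurableU; exact: measurable_sphere_at.
have -> : [set x : euclid R 3 | b (coordinate 0 x)] =
    (b \o coordinate 0) @^-1` [set true].
  by apply/seteqP; split => x.
rewrite -[X in measurable X]setTI.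
by apply: (measurableT_comp mb (measurable_coordinate _)).
Qed.

Section slice_integral.
Variables (b : R -> bool) (f : euclid R 3 -> R).
Hypotheses (mb : measurable_fun setT b) (mf : measurable_fun setT f).
Hypothesis f0 : forall x, 0 <= f x.

(** Pulling back along the translation turns the slice into a condition on X,
    up to the complement of the unit sphere, which is null. *)
Lemma integral_sigma_slice (a : R) :
  (forall x, S x -> two_spheres 2 (translate a x)) ->
  admissible (fun x => f (translate a x)) ->
  (\int[sigma sigma0 a]_(x in slice b) (f x)%:E)%E =
  (E (fun x => f (translate a x) * (b (xc x + a))%:R))%:E.
Proof.
move=> aS af; have mD := measurable_slice mb.
have mS := @measurable_sphere R 2.
have mt := @measurable_translate R 2 a.
have mP : measurable (@translate R 2 a @^-1` slice b).
  by rewrite -[X in measurable X]setTI; exact: mt.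
rewrite /sigma /distribution ge0_integral_pushforward//=; last 2 first.
- by apply/measurable_EFinP; exact: measurable_funTS.
- by move=> x _; rewrite lee_fin.
have aE : admissible (fun x => f (translate a x) * (b (xc x + a))%:R).
  apply: admissibleM => //; apply: admissible_bool.
  apply: (measurableT_comp mb); apply: measurable_funD => //.
  exact: measurable_coordinate.
rewrite -(esphere_EFin hsigma0 aE).
have S0 : sigma0 (~` S) = 0%E.
  by rewrite probability_setC//; have /= -> := hsigma0.1; rewrite subee.
have mfD : measurable_fun (@translate R 2 a @^-1` slice b)
    (fun x => (f (translate a x))%:E).
  by apply/measurable_EFinP; apply: measurable_funTS; exact: af.1.
rewrite (ge0_negligible_integral (measurableC mS) mP mfD _ S0); last first.
  by move=> x _; rewrite lee_fin.
rewrite setDE setCK setIC integral_mkcondr.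
apply: eq_integral => x; rewrite inE => Sx; rewrite patchE.
have bE : (x \in @translate R 2 a @^-1` slice b) = b (xc x + a).
  apply/idP/idP; rewrite inE /slice /= coordinate_translate eqxx mulr1.
    by case.
  by split => //; exact: aS.
by rewrite bE; case: (b _); rewrite ?mulr1 ?mulr0.
Qed.

Lemma integral_rho_slice :
  (forall a, admissible (fun x => f (translate a x))) ->
  (\int[rho sigma0]_(x in slice b) (f x)%:E)%E =
  (2^-1 * (E (fun x => f (translate (-1) x) * (b (xc x + -1))%:R) +
           E (fun x => f (translate 1 x) * (b (xc x + 1))%:R)))%:E.
Proof.
move=> af; have mD := measurable_slice mb.
have mfD : measurable_fun (slice b) (fun x => (f x)%:E).
  by apply/measurable_EFinP; exact: measurable_funTS.
have f0D x : slice b x -> (0 <= (f x)%:E)%E by rewrite lee_fin.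
rewrite /rho ge0_integral_mscale//= ge0_integral_measure_add//.
rewrite !integral_sigma_slice// => x Sx; [right|left]; exact: sphere_translate.
Qed.

End slice_integral.

(** * The least cost of a slice *)

Definition sqdist (v : 'rV[R]_3) (x : euclid R 3) : R :=
  enorm ((x : 'rV_3) - v) ^+ 2.

Lemma sqdist_coordinates (v : 'rV[R]_3) (x : euclid R 3) : sqdist v x =
  (xc x - v 0 0) ^+ 2 + (yc x - v 0 1) ^+ 2 + (zc x - v 0 2%:R) ^+ 2.
Proof. by rewrite /sqdist enorm_sub2 sum3. Qed.

Lemma admissible_sqdist_translate (v : 'rV[R]_3) (a : R) :
  admissible (fun x => sqdist v (translate a x)).
Proof.
under eq_fun do rewrite sqdist_coordinates !coordinate_translate.
have h i : admissible (fun x : euclid R 3 =>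
    (coordinate i x + a * (i == 0)%:R - v 0 i) ^+ 2).
  apply: admissibleX; apply: admissibleD; last exact: admissible_cst.
  by apply: admissibleD; [exact: admissible_coordinate|exact: admissible_cst].
exact: (admissibleD (admissibleD (h 0) (h 1)) (h 2%:R)).
Qed.

Lemma measurable_sqdist (v : 'rV[R]_3) : measurable_fun setT (sqdist v).
Proof.
rewrite (funext (sqdist_coordinates v)).
by apply: measurable_funD; first apply: measurable_funD; apply: measurable_funX;
  apply: measurable_funB => //; exact: measurable_coordinate.
Qed.

(** On the unit sphere the squared distance is affine in the coordinates, and
    the second and third coordinates average to 0 over a slice. *)
Lemma esphere_sqdist (b : R -> bool) (v : 'rV[R]_3) (t : R) :
  measurable_fun setT b ->
  E (fun x => sqdist v (translate t x) * (b (xc x + t))%:R) =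
  (1 + (t - v 0 0) ^+ 2 + v 0 1 ^+ 2 + v 0 2%:R ^+ 2) *
    E (fun x => (b (xc x + t))%:R) +
  2 * (t - v 0 0) * E (fun x => xc x * (b (xc x + t))%:R).
Proof.
move=> mb.
have mh : measurable_fun setT (fun u : R => (b (u + t))%:R : R).
  apply: (measurableT_comp (f := fun c : bool => c%:R : R)) => //.
  apply: (measurableT_comp mb); exact: measurable_funD.
have hM u : `|(b (u + t))%:R : R| <= 1 by case: (b _); rewrite ?normr1 ?normr0.
have ah : admissible (fun x : euclid R 3 => (b (xc x + t))%:R).
  by apply: (admissible_bounded_comp mh hM); exact: admissible_coordinate.
have aih i : admissible (fun x : euclid R 3 =>
    coordinate i x * (b (xc x + t))%:R).
  by apply: admissibleM => //; exact: admissible_coordinate.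
set q := 1 + _ + _ + _; set k := 2 * _.
transitivity (E (fun x => q * (b (xc x + t))%:R +
  (k * (xc x * (b (xc x + t))%:R) +
   ((- 2 * v 0 1) * (yc x * (b (xc x + t))%:R) +
    (- 2 * v 0 2%:R) * (zc x * (b (xc x + t))%:R))))).
  apply: eq_esphere => // x /sphere0P; rewrite sum3 => S1.
  rewrite sqdist_coordinates !coordinate_translate /= !mulr0n !mulr1n.
  rewrite /q /k -!/(coordinate _ x) in S1 *.
  move: (xc x) (yc x) (zc x) (b _) S1 => X Y Z c S1.
  rewrite !mulrA -!mulrDl; congr (_ * _); lra.
have a1 := admissibleZ q ah; have a2 := admissibleZ k (aih 0).
have a3 := admissibleZ (- 2 * v 0 1) (aih 1).
have a4 := admissibleZ (- 2 * v 0 2%:R) (aih 2%:R).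
rewrite (esphereD hsigma0 a1 (admissibleD a2 (admissibleD a3 a4))).
rewrite (esphereD hsigma0 a2 (admissibleD a3 a4)) (esphereD hsigma0 a3 a4).
rewrite !esphereZ//.
rewrite (esphere_y_odd hsigma0 mh hM) (esphere_z_odd hsigma0 mh hM).
by rewrite !mulr0 !addr0.
Qed.

(** The last hypothesis completes the square in the cost of a centre v: [w]
    stands for the first coordinate of v and [r] for the sum of the squares of
    the two others, [m] is the mass of the slice and [u] the first coordinate
    of its barycenter. *)
Lemma min_cost_slice (b : R -> bool) (bl xl br xr Q m u : R) :
  measurable_fun setT b -> 0 <= m ->
  E (fun x => (b (xc x + -1))%:R) = bl ->
  E (fun x => xc x * (b (xc x + -1))%:R) = xl ->
  E (fun x => (b (xc x + 1))%:R) = br ->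
  E (fun x => xc x * (b (xc x + 1))%:R) = xr ->
  (forall w r : R,
     2^-1 * ((1 + (- 1 - w) ^+ 2 + r) * bl + 2 * (- 1 - w) * xl +
     ((1 + (1 - w) ^+ 2 + r) * br + 2 * (1 - w) * xr)) =
     Q + m * ((w - u) ^+ 2 + r)) ->
  min_cost sigma0 (slice b) = Q%:E.
Proof.
move=> mb m0 hbl hxl hbr hxr hq.
have cost v : (\int[rho sigma0]_(x in slice b)
    (enorm ((x : 'rV[R]_3) - v) ^+ 2)%:E)%E =
    (Q + m * ((v 0 0 - u) ^+ 2 + (v 0 1 ^+ 2 + v 0 2%:R ^+ 2)))%:E.
  have := integral_rho_slice mb (measurable_sqdist v).
  move=> ->; last 2 first.
  - by move=> x; exact: sqr_ge0.
  - exact: admissible_sqdist_translate.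
  congr EFin; rewrite -hq !esphere_sqdist// hbl hxl hbr hxr; ring.
apply: minimum_least.
  exists (u *: delta_mx 0 0) => //; rewrite cost !mxE /= !mulr0 mulr1.
  by congr EFin; ring.
move=> _ [v _ <-]; rewrite cost lee_fin lerDl mulr_ge0//.
by rewrite !addr_ge0 ?sqr_ge0.
Qed.

(** The left region has mass (2 - a)/4 and its barycenter has first coordinate
    - (2 + a)/2; for the right one these are (2 + a)/4 and (2 - a)/2. *)
Lemma cut_mseE (a : R) : 0 <= a < 2 -> cut_mse sigma0 a = (1 + a ^+ 2 / 4)%:E.
Proof.
move=> /andP[a0 a2].
have [l0 l1] := @archimedes_law _ _ hsigma0 (1 - a) ltac:(lra).
have [p0 p1] := @archimedes_law _ _ hsigma0 (-1) ltac:(lra).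
have ax : admissible (fun x : euclid R 3 => xc x).
  exact: admissible_coordinate.
have mle : measurable_fun setT (fun u : R => u <= - a).
  exact: measurable_fun_ler.
have mnle : measurable_fun setT (fun u : R => ~~ (u <= - a)).
  by apply: (measurableT_comp (f := negb)).
have al t : admissible (fun x : euclid R 3 => (xc x + t <= - a)%R%:R).
  apply: admissible_bool; apply: measurable_fun_ler => //.
  by apply: measurable_funD => //; exact: measurable_coordinate.
have compl t : E (fun x => (~~ (xc x + t <= - a))%:R) =
    1 - E (fun x => (xc x + t <= - a)%R%:R).
  transitivity (E (fun x => 1 + (-1) * (xc x + t <= - a)%R%:R)).
    by apply: eq_esphere => // x _; case: (_ <= _);
      rewrite /= ?mulr0n ?mulr1n; ring.
  rewrite (esphereD hsigma0 (admissible_cst 1) (admissibleZ (-1) (al t))).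
  by rewrite esphereZ// esphere_cst//; ring.
have complx t : E (fun x => xc x * (~~ (xc x + t <= - a))%:R) =
    - E (fun x => xc x * (xc x + t <= - a)%R%:R).
  have axl := admissibleM ax (al t).
  transitivity (E (fun x => xc x + (-1) * (xc x * (xc x + t <= - a)%R%:R))).
    by apply: eq_esphere => // x _; case: (_ <= _);
      rewrite /= ?mulr0n ?mulr1n; ring.
  rewrite (esphereD hsigma0 ax (admissibleZ (-1) axl)) esphereZ//.
  by rewrite (esphere_x_odd hsigma0); ring.
have left_mass : E (fun x => (xc x + -1 <= - a)%R%:R) = (2 - a) / 2.
  transitivity (E (fun x => (xc x <= 1 - a)%R%:R)); last by rewrite l0; field.
  apply: eq_esphere => // x _; rewrite (_ : (_ <= _) = (xc x <= 1 - a))//.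
  by apply/idP/idP; lra.
have left_moment :
    E (fun x => xc x * (xc x + -1 <= - a)%R%:R) = - (2 - a) * a / 4.
  transitivity (E (fun x => xc x * (xc x <= 1 - a)%R%:R)); last first.
    by rewrite l1; field.
  apply: eq_esphere => // x _; rewrite (_ : (_ <= _) = (xc x <= 1 - a))//.
  by apply/idP/idP; lra.
(* The region meets the right sphere at most in the origin. *)
have [right_mass right_moment] : E (fun x => (xc x + 1 <= - a)%R%:R) = 0 /\
    E (fun x => xc x * (xc x + 1 <= - a)%R%:R) = 0.
  move: a0; rewrite le_eqVlt => /orP[/eqP az|a0].
    have le x : (xc x + 1 <= - a) = (xc x <= -1 :> R) by apply/idP/idP; lra.
    split.
      by under eq_fun do rewrite le; rewrite p0; lra.
    by under eq_fun do rewrite le; rewrite p1; lra.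
  have le (x : euclid R 3) : S x -> (xc x + 1 <= - a) = false.
    move=> Sx; have := sphere_coordinate_le1 0 Sx.
    rewrite ler_norml => /andP[h _].
    by apply/negP => h'; lra.
  split; rewrite -[RHS](esphere_cst hsigma0);
    apply: eq_esphere => // x /le -> //.
  by rewrite mulr0.
have S2E : two_spheres 2 `\` (two_spheres 2 `&` [set x | x 0 0 <= - a]) =
    slice (fun u => ~~ (u <= - a)).
  rewrite setDE setCI setIUr setICr set0U; congr (_ `&` _).
  by apply/seteqP; split => x /= /negP.
rewrite /cut_mse /mse S2E.
have -> : min_cost sigma0 (two_spheres 2 `&` [set x | x 0 0 <= - a]) =
    ((4 - a ^+ 2) * (2 - a) / 16)%:E.
  apply: (@min_cost_slice (fun u => u <= - a) _ _ _ _ _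
    ((2 - a) / 4) (- (2 + a) / 2)
    mle _ left_mass left_moment right_mass right_moment); first by lra.
  by move=> w r; field.
have -> : min_cost sigma0 (slice (fun u => ~~ (u <= - a))) =
    (1 + a ^+ 2 / 4 - (4 - a ^+ 2) * (2 - a) / 16)%:E.
  apply: (@min_cost_slice _ (a / 2) ((2 - a) * a / 4) 1 0 _
    ((2 + a) / 4) ((2 - a) / 2) mnle).
  - lra.
  - by rewrite compl left_mass; field.
  - by rewrite complx left_moment; field.
  - by rewrite compl right_mass; ring.
  - by rewrite complx right_moment; ring.
  - by move=> w r; field.
by rewrite -EFinD; congr EFin; ring.
Qed.

End two_spheres_cost.

Theorem theorem2p4 (R : realType) (sigma0 : probability (euclid R 3) R)
    (hsigma0 : uniform_sphere sigma0) (a : R) (ha : 0 <= a < 2) :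
  (cut_mse sigma0 0 <= cut_mse sigma0 a)%E.
Proof.
rewrite !(cut_mseE hsigma0)//; last by apply/andP; split.
by rewrite lee_fin expr0n /= mul0r addr0 lerDl divr_ge0// sqr_ge0.
Qed.
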